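(* If the flow $(X,T)$ is strongly rigid, then the rigidity relation of the induced flow $(2^X,T)$ is $\mathcal{R}=\Delta$, where $\Delta$ is the identity relation (diagonal) in $2^X\times 2^X$.
   Context: A flow $(X,T)$ is an action $(t,x)\mapsto tx$ of an infinite discrete (not necessarily abelian) group $T$ by homeomorphisms on a compact, infinite metric space $(X,d)$; each $t\in T$ is identified with the map $x\mapsto tx$, and $e\in T$ is the identity. The enveloping semigroup $E(X)$ is the closure of $T$ in $X^X$ with the product (point-open) topology; it is a semigroup under composition. A nonempty $I\subset E(X)$ is a left ideal if $E(X)\cdot I\subset I$; a minimal ideal is a closed left ideal containing no left ideal as a proper subset. A minimal idempotent is an idempotent belonging to a minimal ideal. The flow is strongly rigid if every minimal idempotent $u\in E(X)$ is an accumulation point in $E(X)$ endowed with the compact-open topology, i.e. there is a (non-trivial) net $\{t_k\}$ in $T$ with $t_k\to u$ uniformly on $X$; non-trivial means $t_k\neq u$ for all $k$, and in particular, when $u=e$, no $t_k$ is the identity element of $T$. For a flow $(X,T)$ the rigidity relation $\mathcal{R}\subset X\times X$ is the set of pairs $(x,y)$ for which there exist a (non-trivial) net $\{t_k\}$ in $T$ with $t_k\to e$ uniformly, together with a subnet $\{t_k'\}$ and nets $x_k\to x$, $y_k\to y$ in $X$, such that $d(t_k'x_k,t_k'y_k)\to 0$. $2^X$ is the compact metric space of nonempty closed subsets of $X$ with the Hausdorff metric $d_H$; the induced flow $(2^X,T)$ is given by $tA=\{ta:a\in A\}$. The rigidity relation of $(2^X,T)$ is obtained by applying the definition to this flow,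 with metric $d_H$. *)

(* Defs.v *)
From HB Require Import structures.
From mathcomp Require Import all_boot all_order all_algebra.
From mathcomp Require Import all_classical all_reals all_analysis.

Set Implicit Arguments.
Unset Strict Implicit.
Unset Printing Implicit Defensive.

Import Order.TTheory GRing.Theory Num.Theory.
Import numFieldTopology.Exports.
Import metricType_numDomainType.

Local Open Scope classical_set_scope.
Local Open Scope ring_scope.

(** * Nets *)

Record directedSet := DirectedSet {
  dindex :> Type ;
  dle : dindex -> dindex -> Prop ;
  dle_refl : forall i, dle i i ;
  dle_trans : forall i j k, dle i j -> dle j k -> dle i k ;
  dle_directed : forall i j, exists k, dle i k /\ dle j k ;
  dindex_inhabited : inhabited dindex
}.

(* A net [x : D -> Y] converges to [l] iff [x @ tails D --> l]. *)
Definition tails (D : directedSet) : set_system D :=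
  filter_from [set: D] (fun i => [set j | dle i j]).
Arguments tails : clear implicits.

(* Subnets in the sense of Kelley: [phi] need not be monotone. *)
Definition subnet (Y : Type) (D D' : directedSet) (x : D -> Y) (x' : D' -> Y) :=
  exists phi : D' -> D,
    (forall i, exists j0, forall j, dle j0 j -> dle i (phi j)) /\
    (forall j, x' j = x (phi j)).

(** * Flows *)

Record flow (R : realType) (T : groupType) := Flow {
  phase_space :> metricType R ;
  act : T -> phase_space -> phase_space ;
  group_infinite : infinite_set [set: T] ;
  space_infinite : infinite_set [set: phase_space] ;
  space_compact : compact [set: phase_space] ;
  act1 : forall x, act 1%g x = x ;
  actM : forall s t x, act (s * t)%g x = act s (act t x) ;
  act_continuous : forall t, continuous (act t)
}.

Section Rigidity.
Context {R : realType} {T : groupType} (X : flow R T).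

Definition enveloping_semigroup : set (X -> X) :=
  closure (range (@act R T X) : set {ptws X -> X}).

Definition left_ideal (I : set (X -> X)) :=
  [/\ I !=set0, I `<=` enveloping_semigroup &
      forall p q, enveloping_semigroup p -> I q -> I (p \o q)].

Definition minimal_ideal (I : set (X -> X)) :=
  [/\ closed (I : set {ptws X -> X}), left_ideal I &
      forall J, left_ideal J -> J `<=` I -> J = I].

Definition minimal_idempotent (u : X -> X) :=
  u \o u = u /\ exists2 I, minimal_ideal I & I u.

(* Group elements are compared with [u] as self-maps of [X]; in particular, for
   [u = id] no [t k] acts trivially. *)
Definition nontrivial_uniform_net (D : directedSet) (t : D -> T) (u : X -> X) :=
  (forall k, act (t k) <> u) /\
  {uniform, (fun k => @act R T X (t k)) @ tails D --> u}.

Definition strongly_rigid :=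
  forall u, minimal_idempotent u ->
    exists (D : directedSet) (t : D -> T), nontrivial_uniform_net t u.

Definition rigidity_relation : set (X * X) :=
  [set p | exists (D : directedSet) (t : D -> T)
                  (D' : directedSet) (t' : D' -> T) (x y : D' -> X),
    [/\ nontrivial_uniform_net t id,
        subnet t t',
        x @ tails D' --> p.1,
        y @ tails D' --> p.2 &
        mdist (act (t' k) (x k)) (act (t' k) (y k)) @[k --> tails D'] --> (0 : R)]].

End Rigidity.

Arguments enveloping_semigroup {R T} X _.
Arguments rigidity_relation {R T} X _.

(** * The Hausdorff metric *)

Section HausdorffDistance.
Context {R : realType} {X : metricType R}.
Implicit Types (x y : X) (A B C : set X).

Definition set_dist x A : R := inf [set mdist x a | a in A].

Definition excess A B : R := sup [set set_dist a B | a in A].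

Definition hausdorff_dist A B : R := Num.max (excess A B) (excess B A).

Lemma set_dist_has_lbound x A : has_lbound [set mdist x a | a in A].
Proof. by exists 0 => _ [a _ <-]; exact: mdist_ge0. Qed.

Lemma set_dist_le x A a : A a -> set_dist x A <= mdist x a.
Proof. by move=> Aa; apply: ge_inf; [exact: set_dist_has_lbound|exists a]. Qed.

Lemma set_dist_ge0 x A : A !=set0 -> 0 <= set_dist x A.
Proof.
move=> [a Aa]; apply: lb_le_inf; first by exists (mdist x a), a.
by move=> _ [b _ <-]; exact: mdist_ge0.
Qed.

Lemma set_dist_ltP x A e : A !=set0 ->
  set_dist x A < e <-> exists2 a, A a & mdist x a < e.
Proof.
move=> [a Aa]; split=> [|[b Ab]]; last exact/le_lt_trans/set_dist_le.
by case/inf_lt => [|_ [b Ab <-] ?]; [exists (mdist x a), a|exists b].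
Qed.

Lemma set_dist_triangle x y A : A !=set0 ->
  set_dist x A <= mdist x y + set_dist y A.
Proof.
move=> A0; apply/ler_addgt0Pr => e e0.
have [|a Aa ya] := (set_dist_ltP y (set_dist y A + e) A0).1.
  by rewrite ltrDl.
rewrite (le_trans (set_dist_le x Aa))// (le_trans (metric_triangle x y a))//.
by rewrite -addrA lerD2l ltW.
Qed.

Lemma set_dist0 x A : closed A -> A !=set0 -> set_dist x A <= 0 -> A x.
Proof.
move=> cA A0 xA; apply: cA => U /nbhs_ballP[e /= e0 xeU].
have [|a Aa xa] := (set_dist_ltP x e A0).1; first exact: le_lt_trans e0.
by exists a; split=> //; apply: xeU; rewrite ballEmdist.
Qed.

Hypothesis cptX : compact [set: X].

Lemma mdist_bounded x : exists M : R, forall y, mdist x y <= M.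
Proof.
have /compact_near_coveringP cov := cptX.
have [|M [_ /(_ (M + 1))]] :=
    cov R (pinfty_nbhs R) (fun M y => mdist x y <= M) _.
  move=> y _; exists (ball y 1, [set M | mdist x y + 1 < M]) => /=.
    split; first exact/nbhsx_ballx.
    by exists (mdist x y + 1); split=> //; exact: num_real.
  move=> [z M] /= [+ xyM]; rewrite ballEmdist /= => yz.
  rewrite (le_trans (metric_triangle x y z))// (le_trans _ (ltW xyM))//.
  by rewrite lerD2l ltW.
by rewrite ltrDl ltr01 => /(_ isT) h; exists (M + 1) => y; exact: h.
Qed.

Lemma excess_has_sup A B : A !=set0 -> B !=set0 ->
  has_sup [set set_dist a B | a in A].
Proof.
move=> [a Aa] [b Bb]; split; first by exists (set_dist a B), a.
have [M Mb] := mdist_bounded b; exists M => _ [c Ac <-].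
by rewrite (le_trans (set_dist_le c Bb))// metric_sym.
Qed.

Lemma excess_leP A B e : A !=set0 -> B !=set0 ->
  excess A B <= e <-> forall a, A a -> set_dist a B <= e.
Proof.
move=> A0 B0; have [hs hb] := excess_has_sup A0 B0; split.
  move=> + a Aa; apply: le_trans.
  by apply: ub_le_sup => //; exists a.
by move=> h; apply: ge_sup => // _ [a Aa <-]; exact: h.
Qed.

Lemma excess_ge0 A B : A !=set0 -> B !=set0 -> 0 <= excess A B.
Proof.
move=> A0 B0; have [a Aa] := A0; rewrite (le_trans (set_dist_ge0 a B0))//.
by apply: (excess_leP _ A0 B0).1 => //.
Qed.

Lemma excess_triangle A B C : A !=set0 -> B !=set0 -> C !=set0 ->
  excess A C <= excess A B + excess B C.
Proof.
move=> A0 B0 C0; apply/(excess_leP _ A0 C0) => a Aa.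
apply/ler_addgt0Pr => e e0.
have [|b Bb ab] := (set_dist_ltP a (set_dist a B + e) B0).1.
  by rewrite ltrDl.
rewrite (le_trans (set_dist_triangle a b C0))// addrAC lerD//.
  rewrite (le_trans (ltW ab))// lerD2r.
  by apply: (excess_leP _ A0 B0).1 Aa.
by apply: (excess_leP _ B0 C0).1 Bb.
Qed.

Lemma hausdorff_dist_leP A B e : A !=set0 -> B !=set0 ->
  hausdorff_dist A B <= e <->
  (forall a, A a -> set_dist a B <= e) /\ (forall b, B b -> set_dist b A <= e).
Proof.
move=> A0 B0; rewrite /hausdorff_dist ge_max; split.
  by case/andP=> /(excess_leP _ A0 B0) ? /(excess_leP _ B0 A0) ?.
by move=> [h1 h2]; apply/andP; split; apply/excess_leP.
Qed.

End HausdorffDistance.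

(** * The induced flow on the hyperspace of nonempty closed sets *)

(* Compactness makes the Hausdorff distance a genuine metric; it is a parameter
   of the type so that the metric structure can be inferred from it. *)
Definition hyperspace (R : realType) (X : metricType R)
    (cptX : compact [set: X]) : Type :=
  [set A : set X | closed A /\ A !=set0].

Section Hyperspace.
Context {R : realType} {X : metricType R} (cptX : compact [set: X]).
Local Notation Y := (hyperspace cptX).

HB.instance Definition _ := Choice.copy Y
  (set_type [set A : set X | closed A /\ A !=set0]).

Definition points (A : Y) : set X := val A.

Definition Hyper (A : set X) (cA : closed A) (A0 : A !=set0) : Y :=
  exist _ A (mem_set (conj cA A0)).

Lemma points_inj : injective points. Proof. exact: val_inj. Qed.

Lemma points_closed (A : Y) : closed (points A).
Proof. by case: A => A AP; have [] := set_mem AP. Qed.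

Lemma points_nonempty (A : Y) : points A !=set0.
Proof. by case: A => A AP; have [] := set_mem AP. Qed.

Let dH (A B : Y) : R := hausdorff_dist (points A) (points B).

Let dHxx A : dH A A = 0.
Proof.
have A0 := points_nonempty A; apply/eqP; rewrite eq_le; apply/andP; split.
  by apply/(hausdorff_dist_leP cptX) => //; split=> a Aa;
     rewrite (le_trans (set_dist_le a Aa))// mdistxx.
by rewrite /dH /hausdorff_dist le_max (excess_ge0 cptX).
Qed.

Let dH_positivity A B : dH A B = 0 -> A = B.
Proof.
have [A0 B0] := (points_nonempty A, points_nonempty B).
move=> AB; have /(hausdorff_dist_leP cptX _ A0 B0)[h1 h2] : dH A B <= 0.
  by rewrite AB.
apply: points_inj; apply/seteqP; split=> x ?; apply: set_dist0 => //.
- exact: points_closed.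
- exact: h1.
- exact: points_closed.
- exact: h2.
Qed.

Let dH_sym A B : dH A B = dH B A.
Proof. by rewrite /dH /hausdorff_dist maxC. Qed.

Let dH_triangle B A C : dH A C <= dH A B + dH B C.
Proof.
have [A0 B0 C0] := And3 (points_nonempty A) (points_nonempty B)
  (points_nonempty C).
rewrite /dH {1}/hausdorff_dist ge_max; apply/andP; split.
  by rewrite (le_trans (excess_triangle cptX A0 B0 C0))// lerD// le_max lexx.
by rewrite (le_trans (excess_triangle cptX C0 B0 A0))// addrC lerD//
  le_max lexx orbT.
Qed.

HB.instance Definition _ :=
  isMetric.Build R Y dHxx dH_positivity dH_sym dH_triangle.

Lemma mdist_hyperspaceE (A B : Y) :
  mdist A B = hausdorff_dist (points A) (points B).
Proof. by []. Qed.

Lemma mdist_hyperspace_le (A B : Y) (e : R) :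
  (forall a, points A a -> exists2 b, points B b & mdist a b <= e) ->
  (forall b, points B b -> exists2 a, points A a & mdist b a <= e) ->
  mdist A B <= e.
Proof.
move=> AB BA; rewrite mdist_hyperspaceE; apply/(hausdorff_dist_leP cptX).
- exact: points_nonempty.
- exact: points_nonempty.
- by split=> [a /AB|a /BA] [b Bb ab];
    exact: le_trans (set_dist_le a Bb) ab.
Qed.

Lemma mdist_hyperspace_lt (A B : Y) (e : R) : mdist A B < e ->
  (forall a, points A a -> exists2 b, points B b & mdist a b < e) /\
  (forall b, points B b -> exists2 a, points A a & mdist b a < e).
Proof.
rewrite mdist_hyperspaceE => ABe.
have [A0 B0] := (points_nonempty A, points_nonempty B).
have [h1 h2] := (hausdorff_dist_leP cptX _ A0 B0).1 (lexx _).
by split=> x ?; apply/set_dist_ltP => //; apply: le_lt_trans ABe; auto.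
Qed.

Lemma hyperspace_compact : compact [set: Y].
Proof.
rewrite compact_ultra => F FU _.
pose hits (U : set X) := [set B : Y | points B `&` U !=set0].
pose L := [set x : X | forall U, nbhs x U -> F (hits U)].
have hitsS U V : U `<=` V -> hits U `<=` hits V.
  by move=> UV B [x [Bx /UV ?]]; exists x.
have missL x : ~ L x -> exists2 U, nbhs x U & F (~` hits U).
  move=> /existsNP[U /not_implyP[xU FU']]; exists U => //.
  by have [//|] := in_ultra_setVsetC (hits U) FU.
have upper e : 0 < e -> \forall B \near F, forall x, points B x ->
    exists2 a, L a & mdist x a < e.
  move=> e0; have /compact_near_coveringP cov := cptX.
  have : \forall B \near F, [set: X] `<=` (fun x => points B x ->
    exists2 a, L a & mdist x a < e).
    apply: cov => x _; have [Lx|/missL[U xU FU']] := pselect (L x).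
      exists (ball x e, setT).
        by split; [exact: nbhsx_ballx|exact: filterT].
      move=> [z B] /= [xz _] _; exists x => //.
      by move: xz; rewrite ballEmdist /= metric_sym.
    exists (U, ~` hits U) => // -[z B] /= [Uz hB] Bz.
    by exfalso; apply: hB; exists z.
  by apply: filterS => B h x; exact: h.
have L0 : L !=set0.
  have [B h] := filter_ex (upper 1 ltr01).
  by have [x /h[a La _]] := points_nonempty B; exists a.
have Lc : closed L.
  move=> x clLx U /nbhs_interior/clLx[y [Ly yU]].
  exact: Ly.
have lower e : 0 < e -> \forall B \near F, forall a, L a ->
    exists2 x, points B x & mdist a x < e.
  move=> e0; have Lcpt : compact L by apply: subclosed_compact cptX _.
  have /compact_near_coveringP cov := Lcpt.
  have : \forall B \near F, L `<=` (fun a =>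
    exists2 x, points B x & mdist a x < e).
    apply: cov => a La; exists (ball a (e / 2), hits (ball a (e / 2))).
      have e20 : 0 < e / 2 by rewrite divr_gt0.
      by split; [|apply: La]; exact: nbhsx_ballx.
    move=> [b B] /= [ab [x [Bx ax]]]; exists x => //.
    have := ball_triangle (ball_sym ab) ax.
    by rewrite -splitr ballEmdist.
  by apply: filterS => B h x; exact: h.
exists (Hyper Lc L0); split=> //.
apply/(@fcvgrPdist_lt R Y) => e e0.
have e20 : 0 < e / 2 by rewrite divr_gt0.
apply: filterS2 (upper _ e20) (lower _ e20) => B hu hl.
apply: (@le_lt_trans _ _ (e / 2)); last by rewrite ltr_pdivrMr// ltr_pMr// ltr1n.
apply: mdist_hyperspace_le => a.
  by move=> /hl[x ? ?]; exists x => //; exact: ltW.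
by move=> /hu[x ? ?]; exists x => //; exact: ltW.
Qed.

Lemma hyperspace_infinite : infinite_set [set: X] -> infinite_set [set: Y].
Proof.
have c1 (x : X) : closed [set x].
  by apply: accessible_closed_set1; apply: hausdorff_accessible;
     exact: metric_hausdorff.
pose f x : Y := Hyper (c1 x) (ex_intro _ x erefl).
move=> infX finY; apply: infX.
have finj : set_inj [set: X] f.
  move=> x y _ _ /(congr1 points) /= xy.
  by have : [set x] x by []; rewrite [X in X x]xy.
by apply: (@finite_preimage _ _ [set: Y] f).
Qed.

Section Image.
Variables (f : X -> X) (cf : continuous f).

Lemma image_points_closed (A : Y) : closed (f @` points A).
Proof.
apply: compact_closed; first exact: metric_hausdorff.
apply: continuous_compact; first exact: continuous_subspaceT.
exact: subclosed_compact (@points_closed A) cptX _.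
Qed.

Definition hyper_image (A : Y) : Y :=
  Hyper (@image_points_closed A) (image_nonempty f (points_nonempty A)).

Lemma hyper_image_continuous : continuous hyper_image.
Proof.
move=> A; apply/(@cvgrPdist_le R Y _ _ (nbhs_filter A)) => e e0.
have /compact_near_coveringP cov := cptX.
have : \forall d \near 0^'+, [set: X] `<=` (fun x => forall y,
    mdist x y < d -> mdist (f x) (f y) < e).
  apply: cov => x _.
  have e20 : 0 < e / 2 by rewrite divr_gt0.
  have /(@cvgrPdist_lt R X _ _ (nbhs_filter x)) /(_ _ e20) := @cf x.
  move=> /nbhs_ballP[d /= d0 xd].
  have d20 : 0 < d / 2 by rewrite divr_gt0.
  exists (ball x (d / 2), [set r | r < d / 2]).
    by split; [exact: nbhsx_ballx|exact: nbhs_right_lt].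
  move=> [z r] /= [xz rd] y zy.
  have zyd : ball z (d / 2) y by rewrite ballEmdist /= (lt_trans zy).
  have xy : ball x d y by rewrite [d]splitr; exact: ball_triangle xz zyd.
  have xz' : ball x d z.
    by apply: le_ball xz; rewrite ler_pdivrMr// ler_peMr ?ler1n// ltW.
  rewrite (le_lt_trans (metric_triangle _ (f x) _))// [e]splitr ltrD//.
    by rewrite metric_sym; exact: xd xz'.
  exact: xd xy.
move=> h.
have [d [/= d0 /(_ _ I) hd]] := filter_ex (filterI (nbhs_right_gt 0) h).
have : nbhs A (ball A d) by exact: nbhsx_ballx.
rewrite ballEmdist; apply: filterS => B /mdist_hyperspace_lt[AB BA].
apply: mdist_hyperspace_le => /= _ [x Ax <-].
  by have [y By /hd/ltW xy] := AB x Ax; exists (f y) => //; exists y.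
by have [y By /hd/ltW xy] := BA x Ax; exists (f y) => //; exists y.
Qed.

End Image.
End Hyperspace.

Section InducedFlow.
Context {R : realType} {T : groupType} (X : flow R T).
Local Notation Y := (hyperspace (@space_compact R T X)).

Definition induced_act (t : T) : Y -> Y := hyper_image (@act_continuous R T X t).

Lemma points_induced_act t A : points (induced_act t A) = act t @` points A.
Proof. by []. Qed.

Lemma induced_act1 A : induced_act 1%g A = A.
Proof.
apply: points_inj; rewrite points_induced_act -[RHS]image_id; apply: eq_imagel => x _.
exact: act1.
Qed.

Lemma induced_actM s t A :
  induced_act (s * t)%g A = induced_act s (induced_act t A).
Proof.
apply: points_inj; rewrite !points_induced_act image_comp; apply: eq_imagel => x _.
exact: actM.
Qed.

Lemma induced_act_continuous t : continuous (induced_act t).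
Proof. exact: hyper_image_continuous. Qed.

Definition induced_flow : flow R T :=
  @Flow R T Y induced_act (@group_infinite R T X)
    (hyperspace_infinite (@space_infinite R T X))
    (@hyperspace_compact R X (@space_compact R T X))
    induced_act1 induced_actM induced_act_continuous.

End InducedFlow.

(* Main.v *)
Require Import Defs.
From mathcomp Require Import all_boot all_order all_algebra lra.
From mathcomp Require Import all_classical all_reals all_analysis.

Set Implicit Arguments.
Unset Strict Implicit.
Unset Printing Implicit Defensive.

Import Order.TTheory GRing.Theory Num.Theory.
Import numFieldTopology.Exports.
Import metricType_numDomainType.

Local Open Scope classical_set_scope.
Local Open Scope ring_scope.

(** Strong rigidity speaks only of minimal idempotents, so the first task is to
    produce one. The enveloping semigroup is compact for pointwise convergence,
    and right composition [p |-> p \o q] is continuous on it, whatever [q] is.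
    Zorn's lemma, in the form [compact_minimal_closed], yields a minimal ideal
    ([minimal_ideal_exists]), and used a second time, a minimal closed
    subsemigroup of that ideal, which is forced to contain an idempotent
    ([ellis_numakura]).

    Let [u] be a minimal idempotent, and let [t k] in [T] converge to [u]
    uniformly. Then [u] is continuous and its range is dense, since each [t k] is
    onto. As [u] fixes its range pointwise, [u] is the identity
    ([idempotent_uniform_limit]). Hence some nontrivial net of [T] converges
    uniformly to the identity of [X]. The Hausdorff distance from [A] to [t A] is
    at most the supremum over [a] in [A] of the distance from [a] to [t a], so the
    same net converges uniformly to the identity of the hyperspace; it remains
    nontrivial there because [X] embeds in the hyperspace as the singletons
    ([induced_uniform_net]). With this net, constant nets [x_k = y_k = A] show
    that every pair [(A, A)] is in the rigidity relation
    ([diagonal_rigidity]).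

    The opposite inclusion holds in every flow ([rigidity_sub_diagonal]): along
    [t'_k -> id], each point is moved by a uniformly small amount, so if
    [t'_k x_k] and [t'_k y_k] are close, then so are [x_k] and [y_k], and
    their limits coincide. *)

(** * Minimal closed sets in a compact set *)

Section MinimalClosedSets.
Context {Y : topologicalType}.

(** A chain of nonempty sets is a filter base; by compactness this filter has a
    cluster point, which lies in every closed member. *)
Lemma compact_chain_bigcap (K : set Y) (F : set (set Y)) :
  compact K -> F K -> (forall A, F A -> closed A /\ A !=set0) ->
  total_on F subset -> \bigcap_(A in F) A !=set0.
Proof.
move=> cK FK Fcl Ftot.
have PF : ProperFilter (filter_from F id).
  apply: filter_from_proper => [|A /Fcl[]//].
  apply: filter_from_filter; first by exists K.
  move=> A B FA FB; have [AB|BA] := Ftot _ _ FA FB.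
    by exists A => // x Ax; split=> //; exact: AB.
  by exists B => // x Bx; split=> //; exact: BA.
have [x [_ clx]] : K `&` cluster (filter_from F id) !=set0.
  by apply: cK; exists K.
exists x => A FA; apply: (Fcl A FA).1 => U xU.
by apply: clx => //; exists A.
Qed.

(** Here [Q] is an algebraic condition stable under intersection, such as being
    stable under multiplication; closedness and nonemptiness are kept apart from
    it because nonemptiness survives intersection only along chains. *)
Lemma compact_minimal_closed (Q : set (set Y)) (K : set Y) :
  compact K -> closed K -> K !=set0 -> Q K ->
  (forall F, F `<=` Q -> Q (\bigcap_(A in F) A)) ->
  exists A, [/\ A `<=` K, closed A, A !=set0, Q A &
    forall B, closed B -> B !=set0 -> Q B -> B `<=` A -> B = A].
Proof.
move=> cptK cK K0 QK Qcap.
(* Zorn_bigcup provides maximal elements, so it is applied to complements. *)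
pose P C := [/\ closed (K `\` C), K `\` C !=set0 & Q (K `\` C)].
have [F FP Ftot|C [[cC C0 QC] Cmax]] := @Zorn_bigcup Y P.
  (* Adding [K] to the chain lets the empty chain be treated like the others. *)
  pose G := K |` [set K `\` C | C in F].
  have -> : P (\bigcup_(C in F) C) =
      [/\ closed (\bigcap_(A in G) A), \bigcap_(A in G) A !=set0 &
          Q (\bigcap_(A in G) A)].
    rewrite /P; have -> // : K `\` \bigcup_(C in F) C = \bigcap_(A in G) A.
    apply/seteqP; split=> [x [Kx nx] _ [->//|[C FC <-]]|x Gx].
      by split=> // Cx; apply: nx; exists C.
    split; first by apply: Gx; left.
    move=> [C FC Cx]; have : (K `\` C) x by apply: Gx; right; exists C.
    by case.
  have GP A : G A -> [/\ closed A, A !=set0 & Q A].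
    by move=> [->|[C FC <-]] //; exact: FP.
  split.
  - by apply: closed_bigI => A /GP[].
  - apply: (@compact_chain_bigcap K) => //; first by left.
      by move=> A /GP[].
    move=> _ _ [->|[C FC <-]] [->|[D FD <-]].
    + by left.
    + by right=> x [].
    + by left=> x [].
    + have [CD|DC] := Ftot _ _ FC FD; [right|left]; exact: setDS.
  - by apply: Qcap => A /GP[].
exists (K `\` C); split=> // [B cB B0 QB BC].
apply: contrapT => nBC; apply: (Cmax (~` B)).
  split; first by move=> x Cx Bx; have [] := BC x Bx.
  move=> BsC; apply: nBC; apply/seteqP; split=> // x [Kx nCx].
  by apply: contrapT => nBx; exact/nCx/BsC.
have BK : B `<=` K by move=> x /BC[].
by rewrite /P setDE setCK (setIidr BK).
Qed.

End MinimalClosedSets.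

(** * Idempotents of compact semigroups of self-maps *)

Section PointwiseSelfMaps.
Context {X : topologicalType}.
Local Notation XX := {ptws X -> X}.

Lemma ptws_cvgP (F : set_system XX) (f : XX) : Filter F ->
  (forall x, (fun g : XX => g x) @ F --> f x) -> F --> f.
Proof.
move=> FF Ff; apply/cvg_sup => x; apply/cvg_image.
  by rewrite eqEsubset; split=> // y _; exists (fun=> y).
move=> W /Ff FW; exists ((fun g : XX => g x) @^-1` W) => //.
by rewrite image_preimage// eqEsubset; split=> // y _; exists (fun=> y).
Qed.

Lemma eval_continuous (x : X) : continuous (fun g : XX => g x).
Proof. exact: (@proj_continuous X (fun=> X) x). Qed.

Lemma comp_right_continuous (q : X -> X) :
  continuous ((fun p => p \o q) : XX -> XX).
Proof.
move=> p; apply: (@ptws_cvgP ((fun p : XX => (p \o q : XX)) @ nbhs p)) => x.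
exact: (@eval_continuous (q x) p).
Qed.

Lemma comp_left_continuous (h : X -> X) : continuous h ->
  continuous ((fun q => h \o q) : XX -> XX).
Proof.
move=> ch q; apply: (@ptws_cvgP ((fun q : XX => (h \o q : XX)) @ nbhs q)) => x.
apply: (@continuous_comp XX X X (fun g => g x) h); first exact: eval_continuous.
exact: ch.
Qed.

Hypothesis hX : hausdorff_space X.

Lemma ptws_hausdorff : hausdorff_space XX.
Proof. exact: (@hausdorff_product X (fun=> X)). Qed.

(** In a minimal closed subsemigroup [A], any element [u] is idempotent: [A \o u]
    is again a closed subsemigroup, hence all of [A], so that [v \o u = u] is
    solvable in [A]; the solutions form a closed subsemigroup, hence again all
    of [A], and [u] itself is a solution. *)
Lemma ellis_numakura (S : set XX) : compact S -> S !=set0 ->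
  (forall p q, S p -> S q -> S (p \o q)) -> exists2 u, S u & u \o u = u.
Proof.
move=> cptS S0 SS.
have cl := compact_closed ptws_hausdorff.
pose Q (A : set XX) := forall p q, A p -> A q -> A (p \o q).
have [F FQ p q Fp Fq A FA|A [AS cA A0 QA Amin]] :=
  @compact_minimal_closed XX Q S cptS (cl _ cptS) S0 SS.
  by apply: (FQ A FA); [exact: Fp|exact: Fq].
have [u Au] := A0; exists u; first exact: AS.
have cptA : compact A := subclosed_compact cA cptS AS.
have Au_eq : [set p \o u | p in A] = A.
  apply: Amin.
  - apply: cl; apply: continuous_compact => //.
    exact/continuous_subspaceT/comp_right_continuous.
  - by exists (u \o u), u.
  - move=> _ _ [p Ap <-] [q Aq <-]; exists (p \o u \o q) => //.
    by apply: (QA) => //; exact: QA.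
  - by move=> _ [p Ap <-]; exact: QA.
pose B := A `&` [set v : XX | v \o u = u].
have BA : B = A.
  apply: Amin.
  - apply: closedI => //.
    apply: ((@continuous_closedP XX XX _).1
      (comp_right_continuous (q := u)) [set (u : XX)]).
    exact/accessible_closed_set1/hausdorff_accessible/ptws_hausdorff.
  - by have : A u by []; rewrite -{1}Au_eq => -[v Av vu]; exists v.
  - move=> p q [Ap pu] [Aq qu]; split; first exact: QA.
    by rewrite /= -[RHS]pu -[in RHS]qu.
  - by move=> v [].
by have : A u by []; rewrite -BA => -[].
Qed.

End PointwiseSelfMaps.

(** * Minimal idempotents of the enveloping semigroup *)

Section MinimalIdempotents.
Context {R : realType} {T : groupType} (X : flow R T).
Local Notation XX := {ptws X -> X}.
Local Notation E := (enveloping_semigroup X : set XX).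

Lemma phase_hausdorff : hausdorff_space X.
Proof. exact: metric_hausdorff. Qed.

Lemma enveloping_compact : compact E.
Proof.
apply: (@subclosed_compact XX _ setT) => //; first exact: closed_closure.
have := @tychonoff X (fun=> X) (fun=> setT) (fun=> @space_compact R T X).
by congr compact; apply/seteqP; split.
Qed.

Lemma enveloping_act t : E (act t).
Proof. by apply: subset_closure; exists t. Qed.

(** Left composition by an element of [E] need not be continuous, so the two
    factors are approximated one at a time: [p \o q] is continuous in [p], which
    reduces to [p = act t], and [act t \o q] is continuous in [q]. *)
Lemma enveloping_comp p q : E p -> E q -> E (p \o q).
Proof.
move=> Ep Eq.
suff : E `<=` (fun p : XX => (p \o q : XX)) @^-1` E by apply.
rewrite {1}/enveloping_semigroup closureE; apply: smallest_sub.
  apply: ((@continuous_closedP XX XX _).1 (comp_right_continuous (q := q)) E).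
  exact: closed_closure.
move=> _ [t _ <-] /=.
suff : E `<=` (fun q : XX => (act t \o q : XX)) @^-1` E by apply.
rewrite {1}/enveloping_semigroup closureE; apply: smallest_sub.
  apply: ((@continuous_closedP XX XX _).1
    (comp_left_continuous (@act_continuous R T X t)) E).
  exact: closed_closure.
move=> _ [s _ <-] /=; have -> : act t \o act s = act (t * s)%g :> (X -> X).
  by apply/funext => x; rewrite /= actM.
exact: enveloping_act.
Qed.

(** Zorn's lemma gives minimality among closed left ideals only. It extends to an
    arbitrary left ideal [J] inside: for [q] in [J], the left ideal [E \o q] is
    contained in [J], and it is closed as a continuous image of a compact set. *)
Lemma minimal_ideal_exists : exists I, minimal_ideal (X := X) I.
Proof.
pose Q (A : set XX) := forall p q, E p -> A q -> A (p \o q).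
have cE : closed E by exact: closed_closure.
have E0 : E !=set0 by exists (act 1%g); exact: enveloping_act.
have [F FQ p q Ep Fq A FA|I [IE cI I0 QI Imin]] :=
  @compact_minimal_closed XX Q E enveloping_compact cE E0 enveloping_comp.
  by apply: (FQ A FA) => //; exact: Fq.
exists I; split=> // J [[q Jq] JE QJ] JI.
have EqJ : [set p \o q | p in E] `<=` J by move=> _ [p Ep <-]; exact: QJ.
apply/seteqP; split=> //.
have <- // : [set p \o q | p in E] = I.
apply: Imin.
- apply: compact_closed; first exact/ptws_hausdorff/phase_hausdorff.
  apply: continuous_compact; last exact: enveloping_compact.
  exact/continuous_subspaceT/comp_right_continuous.
- by exists (act 1%g \o q), (act 1%g) => //; exact: enveloping_act.
- move=> r _ Er [p Ep <-]; exists (r \o p) => //; exact: enveloping_comp.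
- exact: subset_trans JI.
Qed.

Lemma minimal_idempotent_exists : exists u, minimal_idempotent (X := X) u.
Proof.
have [I Imin] := minimal_ideal_exists; have [cI [I0 IE QI] _] := Imin.
have cptI : compact (I : set XX).
  exact: subclosed_compact cI (@enveloping_compact) IE.
have [p q Ip Iq|u Iu uu] := ellis_numakura (@phase_hausdorff) cptI I0.
  by apply: QI => //; exact: IE.
by exists u; split=> //; exists I.
Qed.

End MinimalIdempotents.

(** * Uniform limits *)

Section UniformConvergence.
Context {R : realType}.

Lemma uniform_cvg_mdistP (U : choiceType) (V : metricType R)
    (F : set_system (U -> V)) (f : U -> V) : Filter F ->
  {uniform, F --> f} <->
  forall e : R, 0 < e -> \forall g \near F, forall x, mdist (f x) (g x) < e.
Proof.
move=> FF; split=> [Ff e e0|Ff A /uniform_nbhs[E [entE EA]]].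
  apply: Ff; apply/uniform_nbhs.
  exists [set xy | ball xy.1 e xy.2]; split.
    exact: (entourage_ball V (PosNum e0)).
  by move=> g /= fg x; have := fg x I; rewrite ballEmdist.
move: entE; rewrite -entourage_ballE => -[e /= e0 eE].
apply: filterS (Ff e e0) => g fg; apply: EA => y _; apply: eE => /=.
by rewrite ballEmdist; exact: fg.
Qed.

(** Given [y], choose [g] uniformly close to [u] and [x] with [g x = y]. Then [u x]
    is close to [y], and [u] fixes it; by continuity of [u], the point [y] is
    fixed as well. *)
Lemma idempotent_uniform_limit (V : metricType R) (F : set_system (V -> V))
    (u : V -> V) : ProperFilter F ->
  (\forall g \near F, continuous g /\ forall y, exists x, g x = y) ->
  {uniform, F --> u} -> u \o u = u -> u = id.
Proof.
move=> PF Fg Fu uu.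
have cu : continuous u.
  by apply: uniform_limit_continuous Fu; apply: filterS Fg => g [].
(* [u x] lies both in the neighborhood [A] of [u y] and in [B] of [y]. *)
apply/funext => y; apply: metric_hausdorff => A B.
move=> /= /(cu y)/= /nbhs_ballP[e /= e0 yA] /nbhs_ballP[d /= d0 yB].
have m0 : 0 < Num.min e d by rewrite lt_min e0.
have [g [[_ /(_ y)[x gx]] /(_ x)]] := filter_ex
  (filterI Fg ((uniform_cvg_mdistP _ _).1 Fu _ m0)).
rewrite gx metric_sym lt_min => /andP[uxe uxd].
exists (u x); split; last by apply: yB; rewrite ballEmdist.
have /yA : ball y e (u x) by rewrite ballEmdist.
by rewrite /= -[u (u x)]/((u \o u) x) uu.
Qed.

End UniformConvergence.

(** * The rigidity relation *)

Section Rigidity.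
Context {R : realType} {T : groupType}.
Implicit Type X : flow R T.

#[local] Instance tails_proper (D : directedSet) : ProperFilter (tails D).
Proof.
apply: filter_from_proper => [|i _]; last by exists i; exact: dle_refl.
apply: filter_from_filter; first by have [i] := dindex_inhabited D; exists i.
move=> i j _ _; have [k [ik jk]] := dle_directed i j.
by exists k => // l kl; split; exact: dle_trans kl.
Qed.

Lemma strongly_rigid_uniform_net X : strongly_rigid X ->
  exists (D : directedSet) (t : D -> T), nontrivial_uniform_net (X := X) t id.
Proof.
have [u umin] := minimal_idempotent_exists X.
move=> /(_ _ umin)[D [t [tu ut]]]; exists D, t.
suff <- : u = id by [].
apply: (idempotent_uniform_limit (F := (fun k => @act R T X (t k)) @ tails D)).
- apply: (filterE (F := tails D)) => k /=; split.
    exact: act_continuous.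
  by move=> y; exists (act (t k)^-1%g y); rewrite -actM mulgV act1.
- exact: ut.
- exact: umin.1.
Qed.

Lemma induced_uniform_net X (D : directedSet) (t : D -> T) :
  nontrivial_uniform_net (X := X) t id ->
  nontrivial_uniform_net (X := induced_flow X) t id.
Proof.
move=> [tid ut]; split=> [k tk|].
  apply: (tid k); apply/funext => x.
  (* If [t k] fixes every closed set, it fixes every singleton. *)
  have c1 : closed [set x].
    exact/accessible_closed_set1/hausdorff_accessible/metric_hausdorff.
  pose x1 := Hyper (@space_compact R T X) c1 (ex_intro _ x erefl).
  have /(congr1 (@points _ _ _)) : induced_act (t k) x1 = x1.
    exact: (congr1 (@^~ x1) tk).
  by rewrite points_induced_act /= image_set1 => /seteqP[/(_ _ erefl)].
apply/uniform_cvg_mdistP => e e0.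
have e20 : 0 < e / 2 by rewrite divr_gt0.
have near_id : \forall k \near tails D, forall x : X, mdist x (act (t k) x) < e / 2.
  exact: (uniform_cvg_mdistP _ _).1 ut _ e20.
suff : \forall k \near tails D, forall A, mdist A (@induced_act R T X (t k) A) < e.
  by [].
apply: filterS near_id => k h A.
apply: (@le_lt_trans _ _ (e / 2)); last by rewrite ltr_pdivrMr// ltr_pMr// ltr1n.
apply: mdist_hyperspace_le => [a Aa|_ [a Aa <-]].
  by exists (act (t k) a); [exists a|exact/ltW/h].
by exists a => //; rewrite metric_sym; exact/ltW/h.
Qed.

Lemma diagonal_rigidity X (D : directedSet) (t : D -> T) :
  nontrivial_uniform_net (X := X) t id -> diagonal `<=` rigidity_relation X.
Proof.
move=> ut [x y] xy; have {xy y}<- : x = y by [].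
exists D, t, D, t, (fun=> x), (fun=> x); split=> //.
- exists id; split=> // i; by exists i.
- exact: cvg_cst.
- exact: cvg_cst.
- under eq_fun do rewrite mdistxx; exact: cvg_cst.
Qed.

Lemma rigidity_sub_diagonal X : rigidity_relation X `<=` diagonal.
Proof.
move=> [a b] /= [D [t [D' [t' [x [y [[_ ut] [phi [phiD tE]] xa yb xy]]]]]]].
apply: mdist_positivity; apply/eqP; rewrite eq_le mdist_ge0 andbT.
apply/ler_addgt0Pr => e e0; rewrite add0r.
(* The path from [a] to [b] through [x k], [t' k (x k)], [t' k (y k)] and [y k]
   has five steps. *)
have e50 : 0 < e / 5%:R by rewrite divr_gt0.
have [i _ hi] := (uniform_cvg_mdistP _ _).1 ut _ e50.
have [j0 hj0] := phiD i.
have tt' : \forall k \near tails D', forall z : X, mdist z (act (t' k) z) < e / 5%:R.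
  by exists j0 => // k /hj0/hi; rewrite tE.
have xa_near : \forall k \near tails D', mdist a (x k) < e / 5%:R.
  exact: (cvgrPdist_lt _ _).1 xa _ e50.
have yb_near : \forall k \near tails D', mdist b (y k) < e / 5%:R.
  exact: (cvgrPdist_lt _ _).1 yb _ e50.
have xy_near := xy _ (nbhsx_ballx (0 : R) _ e50).
have [k [[[/= xk yk] xyk] tk]] := filter_ex (F := tails D')
  (filterI (filterI (filterI xa_near yb_near) xy_near) tt').
move: xyk; rewrite /ball /= sub0r normrN ger0_norm ?mdist_ge0// => xyk.
have /ltW h1 := tk (x k); have /ltW h2 := tk (y k).
have := metric_triangle a (x k) b.
have := metric_triangle (x k) (act (t' k) (x k)) b.
have := metric_triangle (act (t' k) (x k)) (act (t' k) (y k)) b.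
have := metric_triangle (act (t' k) (y k)) (y k) b.
rewrite (metric_sym _ (y k)) (metric_sym (y k) b).
lra.
Qed.

End Rigidity.

Theorem proposition2p27 (R : realType) (T : groupType) (X : flow R T) :
  strongly_rigid X ->
  rigidity_relation (induced_flow X) = diagonal.
Proof.
move=> /strongly_rigid_uniform_net[D [t /induced_uniform_net ut]].
apply/seteqP; split; first exact: rigidity_sub_diagonal.
exact: diagonal_rigidity ut.
Qed.
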